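(* Let $\Gamma$ be a finite simple graph with at least one edge, with adjacency eigenvalues $\lambda_1\ge\cdots\ge\lambda_n$, whose eigenvalue $\lambda_1$ has a positive eigenvector $\nu$, normalized so that its minimum entry in each connected component of $\Gamma$ is $1$. Then the weight Shannon capacity $\Theta^*$ of $\Gamma$ satisfies $$\Theta^*\le \frac{\|\nu\|^2}{1-\frac{\lambda_1}{\lambda_n}}.$$
   Context: Eigenvalues of a graph are those of its adjacency matrix, listed with multiplicity; $\|\cdot\|$ is the Euclidean norm. For a graph $G$ whose largest eigenvalue has a positive eigenvector $\nu$, normalized to have minimum entry $1$ in each connected component, the weight of a vertex subset $U$ is $\|\rho U\|^2=\sum_{u\in U}\nu_u^2$, where $\rho U=\sum_{u\in U}\nu_u e_u$ ($e_u$ the canonical basis vector). The weight independence number is $\alpha^*(G)=\max\{\|\rho U\|^2: U \text{ is an independent set of } G\}$. For $k\ge 1$, $\Gamma^k$ denotes the (strong) product of $k$ copies of $\Gamma=(V,E)$: its vertex set is $V^k$, and two distinct vertices $(u_1,\ldots,u_k)$, $(v_1,\ldots,v_k)$ are adjacent iff for every $1\le i\le k$ either $u_i=v_i$ or $u_i$ is adjacent to $v_i$ in $\Gamma$. The positive eigenvector of $\Gamma^k$ used for its weights is $\nu\otimes\cdots\otimes\nu$ ($k$ factors), i.e. the vertex $(u_1,\ldots,u_k)$ has entry $\nu_{u_1}\cdots\nu_{u_k}$. The weight Shannon capacity is $\Theta^*=\sup_{k\ge 1}\sqrt[k]{\alpha^*(\Gamma^k)}$. *)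

(* Defs.v *)
From HB Require Import structures.
From mathcomp Require Import all_boot all_order all_algebra.
From mathcomp Require Import all_classical all_reals all_analysis.

Set Implicit Arguments.
Unset Strict Implicit.
Unset Printing Implicit Defensive.

Import Order.TTheory GRing.Theory Num.Theory.

Local Open Scope ring_scope.

Record sgraph := SGraph {
  vertex :> finType;
  adj : rel vertex;
  adj_sym : symmetric adj;
  adj_irr : irreflexive adj
}.

Definition independent (G : sgraph) (U : {set G}) : bool :=
  [forall x in U, forall y in U, ~~ adj x y].

Section StrongPower.
Variables (G : sgraph) (k : nat).

Definition spow_adj : rel {ffun 'I_k -> G} :=
  fun u v => (u != v) && [forall i, (u i == v i) || adj (u i) (v i)].

Lemma spow_adj_sym : symmetric spow_adj.
Proof.
move=> u v; rewrite /spow_adj eq_sym; congr (_ && _).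
by apply: eq_forallb => i; rewrite eq_sym adj_sym.
Qed.

Lemma spow_adj_irr : irreflexive spow_adj.
Proof. by move=> u; rewrite /spow_adj eqxx. Qed.

Definition spow : sgraph := SGraph spow_adj_sym spow_adj_irr.

End StrongPower.

Section Weights.
Variables (R : realType) (G : sgraph).
Implicit Types (nu : G -> R) (U : {set G}).

(* The norm that the library puts on row and column vectors is the sup norm,
   so the Euclidean norm of a vector indexed by the vertices is given here. *)
Definition enorm (v : G -> R) : R := Num.sqrt (\sum_(x : G) v x ^+ 2).

Definition rho nu U : G -> R := fun x => if x \in U then nu x else 0.

Definition weight nu U : R := enorm (rho nu U) ^+ 2.

(* The default value 0 is harmless: it is the weight of the empty set, which
   is independent. *)
Definition walpha nu : R :=
  \big[Num.max/0]_(U : {set G} | independent U) weight nu U.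

Definition tensor_pow nu (k : nat) : spow G k -> R :=
  fun u => \prod_(i < k) nu (u i).

End Weights.

(* The supremum is taken in the extended reals, because the supremum of an
   unbounded set of reals is 0 by convention. *)
Definition wshannon (R : realType) (G : sgraph) (nu : G -> R) : \bar R :=
  ereal_sup [set ((walpha (@tensor_pow R G nu k)) `^ (k%:R^-1))%:E
            | k in [set k : nat | (1 <= k)%N]]%classic.

Section Spectrum.
Variables (R : realType) (G : sgraph).
Implicit Type nu : G -> R.

Definition adjmx : 'M[R]_#|G| :=
  \matrix_(i, j) (adj (enum_val i) (enum_val j))%:R.

(* s lists the eigenvalues with multiplicity, in nonincreasing order. *)
Definition adj_eigenvalues (s : seq R) : Prop :=
  sorted >=%R s /\ char_poly adjmx = \prod_(x <- s) ('X - x%:P).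

Definition adj_eigenvector (a : R) nu : Prop :=
  nu <> (fun=> 0) /\
  let v := \col_(i < #|G|) nu (enum_val i) in adjmx *m v = a *: v.

Definition component_normalized nu : Prop :=
  forall x : G, exists y : G,
    [/\ connect (@adj G) x y, nu y = 1
      & forall z : G, connect (@adj G) x z -> 1 <= nu z].

End Spectrum.

(* Main.v *)
(** Let A be the adjacency matrix, tau = - lambda_n > 0 and theta the claimed
    bound.  Since theta (1 + lambda_1 / tau) = ||nu||^2, the matrix
    B = theta (I + A / tau) satisfies B >= nu nu^T in the Loewner order: both
    sides agree on nu, and B >= 0 on the orthogonal complement of nu.  So B is
    a Gram matrix sum_l p_l p_l^T with nu among the p_l, and the k-th tensor
    power of B is a Gram matrix with nu (x) ... (x) nu among its vectors.
    That power has diagonal theta^k and vanishes at pairs of distinct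
    nonadjacent vertices of the strong power.  Testing it on rho U, for U
    independent of weight w, gives w^2 <= theta^k w. *)
Require Import Defs.
From HB Require Import structures.
From mathcomp Require Import all_boot all_order all_algebra.
From mathcomp Require Import all_classical all_reals all_analysis.
From mathcomp Require Import complex ring.
Set Implicit Arguments.
Unset Strict Implicit.
Unset Printing Implicit Defensive.
Import Order.TTheory GRing.Theory Num.Theory.
Local Open Scope ring_scope.

(** Diagonalise [M] as a Hermitian matrix over [R[i]] and scale each eigenvector by the square root
    of its eigenvalue. *)
Lemma psd_gram (R : rcfType) n (M : 'M[R]_n) :
    M^T = M -> (forall x, eigenvalue M x -> 0 <= x) ->
  exists q : bool * 'I_n -> 'I_n -> R,
    forall i j, M i j = \sum_l q l i * q l j.
Proof.
move=> symM M_ge0; pose A : 'M[R[i]]_n := map_mx (real_complex R) M.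
have hermA : A \is hermsymmx.
  apply: realsym_hermsym.
    by apply/is_hermitianmxP; rewrite expr0 scale1r map_mx_id // /A map_trmx symM.
  apply/mxOverP=> i j; rewrite mxE realE !lecE /= eqxx /=; exact: le_total.
have /orthomx_spectralP eqA := hermitian_normalmx hermA.
have /mxOverP d_real := hermitian_spectral_diag_real hermA.
have uP := spectral_unitarymx A.
move: (spectralmx A) (spectral_diag A) uP eqA d_real => P d uP eqA d_real.
have unitP := unitarymx_unit uP.
pose e l := complex.Re (d 0 l).
have dE l : d 0 l = (real_complex R (e l)) by rewrite RRe_real.
(* Row [l] of the invertible [P] is a nonzero left eigenvector of [A] for [d 0 l]. This value is
   real, so it is also an eigenvalue of [M]. *)
have e_ge0 l : 0 <= e l.
  apply: M_ge0.
  suff: eigenvalue A (d 0 l) by rewrite dE (eigenvalue_map (real_complex R)).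
  apply/eigenvalueP; exists (row l P).
    rewrite -row_mul eqA !mulmxA mulmxV // mul1mx row_mul row_diag_mx.
    by rewrite -scalemxAl -rowE.
  apply/eqP=> P0; have := @row_mul _ _ _ _ l P (invmx P).
  rewrite P0 mul0mx mulmxV // => /matrixP/(_ 0 l).
  by rewrite !mxE eqxx => /eqP; rewrite oner_eq0.
(* Real and imaginary parts of the eigenvectors serve as separate real Gram
   vectors, since Re (conj z * z') = Re z * Re z' + Im z * Im z'. *)
pose c (b : bool) (z : R[i]) := if b then complex.Re z else complex.Im z.
exists (fun l i => Num.sqrt (e l.2) * c l.1 (P l.2 i)) => i j.
have -> : M i j = complex.Re (A i j) by rewrite mxE.
rewrite eqA invmx_unitary // !mxE.
rewrite -(pair_bigA _ (fun b l => (Num.sqrt (e l) * c b (P l i)) *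
  (Num.sqrt (e l) * c b (P l j)))) /= big_bool /= -big_split /=.
rewrite raddf_sum; apply: eq_bigr => l _ /=.
rewrite mul_mx_diag !mxE dE /=.
rewrite -{1}(sqr_sqrtr (e_ge0 l)).
case: (P l i) (P l j) => [a b] [a' b'] /=.
ring.
Qed.

Lemma enorm_sqr (R : realType) (G : sgraph) (f : G -> R) :
  enorm f ^+ 2 = \sum_x f x ^+ 2.
Proof. by rewrite sqr_sqrtr // sumr_ge0 // => x _; rewrite sqr_ge0. Qed.

Lemma weightE (R : realType) (G : sgraph) (nu : G -> R) (U : {set G}) :
  weight nu U = \sum_(x in U) nu x ^+ 2.
Proof.
rewrite /weight enorm_sqr [RHS]big_mkcond; apply: eq_bigr => x _.
by rewrite /rho; case: ifP; rewrite // expr0n.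
Qed.

Lemma spow_weight_le (R : realType) (G : sgraph) (I : finType)
    (q : I -> G -> R) (l0 : I) (theta : R) :
    0 <= theta ->
    (forall x, \sum_l q l x * q l x = theta) ->
    (forall x y, x != y -> ~~ adj x y -> \sum_l q l x * q l y = 0) ->
  forall k (U : {set spow G k}), independent U ->
    weight (@tensor_pow R G (q l0) k) U <= theta ^+ k.
Proof.
move=> theta_ge0 q_diag q_nonadj k U indU; rewrite weightE.
set t := @tensor_pow _ _ _ _; set w := \sum_(u in U) _.
pose F (f : {ffun 'I_k -> I}) (u : spow G k) := \prod_i q (f i) (u i).
(* The Gram matrix of the tensor products [F f] is the tensor power of the Gram matrix of [q]. *)
have gramF u v : \sum_f F f u * F f v = \prod_i \sum_l q l (u i) * q l (v i).
  by rewrite bigA_distr_bigA; apply: eq_bigr => f _; rewrite -big_split.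
have gramF_diag u : \sum_f F f u * F f u = theta ^+ k.
  by rewrite gramF (eq_bigr _ (fun i _ => q_diag (u i))) prodr_const card_ord.
have gramF_ind u v : u \in U -> v \in U -> u != v -> \sum_f F f u * F f v = 0.
  move=> uU vU neq_uv; rewrite gramF.
  move/forall_inP/(_ _ uU)/forall_inP/(_ _ vU): indU.
  (* At some coordinate [m] the entries of [u] and [v] are distinct and nonadjacent, so the factor
     at [m] vanishes. *)
  rewrite /= /spow_adj neq_uv /= negb_forall => /existsP[m].
  by rewrite negb_or => /andP[? ?]; rewrite (bigD1 m) //= q_nonadj // mul0r.
have w_ge0 : 0 <= w by rewrite sumr_ge0 // => u _; rewrite sqr_ge0.
have sum_sqr : \sum_f (\sum_(u in U) t u * F f u) ^+ 2 = theta ^+ k * w.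
  under eq_bigr => f _ do rewrite expr2 big_distrlr /=.
  rewrite exchange_big mulr_sumr; apply: eq_bigr => u uU.
  rewrite exchange_big (bigD1 u) //= [X in _ + X]big1 ?addr0;
    last move=> v /andP[vU neq_vu].
    rewrite -(gramF_diag u) mulr_suml; apply: eq_bigr => f _; ring.
  transitivity (t u * t v * \sum_f F f u * F f v).
    rewrite mulr_sumr; apply: eq_bigr => f _; ring.
  by rewrite gramF_ind ?mulr0 // eq_sym.
have : w ^+ 2 <= theta ^+ k * w.
  (* For the constant function [l0], [F f] is [t] itself, so its term is [w ^+ 2]; the other squares
     are dropped. *)
  rewrite -sum_sqr (bigD1 [ffun=> l0]) //=.
  have -> : \sum_(u in U) t u * F [ffun=> l0] u = w.
    apply: eq_bigr => u _; rewrite expr2; congr (_ * _).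
    by apply: eq_bigr => i _; rewrite ffunE.
  by rewrite lerDl sumr_ge0 // => f _; rewrite sqr_ge0.
have [-> _|w_gt0] := eqVneq w 0; first by rewrite exprn_ge0.
by rewrite expr2 ler_pM2r // lt_def w_gt0.
Qed.

(** The value of [v^T *m v] is chosen so that deflation sends [v] to 0. Every nonzero eigenvalue [x]
    then comes from an eigenvalue of [A], whose lower bound [- tau] gives [0 <= x]. *)
Lemma deflation_eigenvalue_ge0 (R : realFieldType) n (A : 'M[R]_n) (v : 'cV_n)
    (a tau theta x : R) :
    0 < tau -> 0 < theta -> A *m v = a *: v ->
    (v^T *m v) 0 0 = theta * (1 + a / tau) ->
    (forall y, eigenvalue A y -> - tau <= y) ->
    eigenvalue (theta *: (1%:M + tau^-1 *: A) - v *m v^T) x ->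
  0 <= x.
Proof.
move=> tau_gt0 theta_gt0 Av vv A_ge /eigenvalueP[w wM w_neq0].
set M := (X in w *m X = _) in wM.
have [-> //|x_neq0] := eqVneq x 0.
have Mv : M *m v = 0.
  rewrite mulmxBl -mulmxA (mx11_scalar (v^T *m v)) vv mul_mx_scalar.
  rewrite -scalemxAl mulmxDl mul1mx -scalemxAl Av -[in v + _](scale1r v).
  by rewrite !scalerA -scalerDl scalerA mulr1 [_^-1 * a]mulrC subrr.
(* A left eigenvector of the deflated matrix for x != 0 is orthogonal to v,
   hence is a left eigenvector of A. *)
have wv : w *m v = 0.
  apply/eqP; rewrite -[_ == 0](inj_eq (scalerI x_neq0)) scaler0.
  by rewrite scalemxAl -wM -mulmxA Mv mulmx0.
(* Obtained by solving [theta * (1 + y / tau) = x] for [y]. *)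
have : eigenvalue A (tau * (x / theta - 1)).
  apply/eigenvalueP; exists w => //.
  move: wM; rewrite mulmxBr mulmxA wv mul0mx subr0 -scalemxAr mulmxDr mulmx1.
  rewrite -scalemxAr => /(congr1 ( *:%R theta^-1)).
  rewrite !scalerA mulVf ?gt_eqF // scale1r => /(canRL (addKr _)) wA.
  rewrite -[w *m A](scalerKV (lt0r_neq0 tau_gt0)) wA.
  by rewrite -scaleN1r -scalerDl scalerA; congr (_ *: _); ring.
move/A_ge; rewrite mulrBr mulr1 -subr_ge0 opprK addrNK.
by rewrite pmulr_rge0 // pmulr_lge0 // invr_gt0.
Qed.

Lemma adj_eigenvalueP (R : realType) (G : sgraph) (s : seq R) (x : R) :
  adj_eigenvalues G s -> eigenvalue (adjmx R G) x = (x \in s).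
Proof. by case=> _ sE; rewrite eigenvalue_root_char sE root_prod_XsubC. Qed.

Lemma adj_eigenvalue_ge_last (R : realType) (G : sgraph) (s : seq R) (x : R) :
  adj_eigenvalues G s -> eigenvalue (adjmx R G) x -> last 0 s <= x.
Proof.
move=> sE; rewrite (adj_eigenvalueP _ sE).
case: sE => s_sorted _; case/lastP: s s_sorted => // s b.
rewrite last_rcons (sorted_pairwise ge_trans) pairwise_rcons.
move=> /andP[/allP le_b _].
by rewrite mem_rcons inE => /predU1P[-> //|/le_b].
Qed.

(** At an endpoint [x] of an edge, [a * nu x] is the sum of [nu] over the neighbours of [x], hence
    positive. *)
Lemma adj_eigenvalue_gt0 (R : realType) (G : sgraph) (a : R) (nu : G -> R) :
    (exists x y : G, adj x y) -> (forall x, 0 < nu x) ->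
  adj_eigenvector a nu -> 0 < a.
Proof.
move=> [x [y xy]] nu_gt0 [_ /= /matrixP/(_ (enum_rank x) 0)].
rewrite !mxE enum_rankK => nu_eq; rewrite -(pmulr_lgt0 _ (nu_gt0 x)) -nu_eq.
rewrite (bigD1 (enum_rank y)) //= !mxE !enum_rankK xy mul1r.
rewrite ltr_wpDr // sumr_ge0 // => i _.
by rewrite !mxE mulr_ge0 ?ler0n // ltW.
Qed.

(** The adjacency matrix has trace 0, so the eigenvalues sum to 0 and cannot all be nonnegative when
    one is positive. *)
Lemma last_adj_eigenvalue_lt0 (R : realType) (G : sgraph) (s : seq R) :
  adj_eigenvalues G s -> 0 < head 0 s -> last 0 s < 0.
Proof.
move=> sE head_gt0; rewrite ltNge; apply/negP=> last_ge0.
have s_ge0 x : x \in s -> 0 <= x.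
  rewrite -(adj_eigenvalueP _ sE) => /(adj_eigenvalue_ge_last sE).
  exact: le_trans.
case: sE => _ sE.
have s_neq0 : size s != 0%N.
  by case: s head_gt0 {s_ge0 sE last_ge0} => //=; rewrite ltxx.
have sizeE : #|G| = size s.
  by have := size_char_poly (adjmx R G); rewrite sE size_prod_XsubC => -[].
have : \sum_(x <- s) x = 0.
  apply: oppr_inj; rewrite -(coefPn_prod_XsubC s_neq0) -sE -sizeE.
  rewrite char_poly_trace ?sizeE ?lt0n // /mxtrace big1 // => i _.
  by rewrite !mxE adj_irr.
case: s head_gt0 s_ge0 {last_ge0 sE s_neq0 sizeE} => [|a s] /=.
  by rewrite ltxx.
move=> a_gt0 s_ge0; rewrite big_cons => /eqP; rewrite gt_eqF // ltr_wpDr //.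
by rewrite big_seq sumr_ge0 // => x xs; rewrite s_ge0 // inE xs orbT.
Qed.

Theorem theorem3p3 (R : realType) (G : sgraph)
    (has_edge : exists x y : G, adj x y)
    (lambda : seq R) (lambdaE : adj_eigenvalues G lambda)
    (nu : G -> R)
    (nu_eigen : adj_eigenvector (head 0 lambda) nu)
    (nu_gt0 : forall x : G, 0 < nu x)
    (nu_norm : component_normalized nu) :
  (wshannon nu <=
     (enorm nu ^+ 2 / (1 - head 0 lambda / last 0 lambda))%:E)%E.
Proof.
have a_gt0 := adj_eigenvalue_gt0 has_edge nu_gt0 nu_eigen.
have last_lt0 := last_adj_eigenvalue_lt0 lambdaE a_gt0.
have A_ge x := adj_eigenvalue_ge_last (x := x) lambdaE.
set a := head 0 lambda in a_gt0 nu_eigen *.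
set b := last 0 lambda in last_lt0 A_ge *.
clearbody a b; pose tau := - b.
have tau_gt0 : 0 < tau by rewrite oppr_gt0.
have -> : 1 - a / b = 1 + a / tau by rewrite /tau invrN mulrN.
set theta := _ / _.
have den_gt0 : 0 < 1 + a / tau by rewrite addr_gt0 // divr_gt0.
have nu2E : enorm nu ^+ 2 = theta * (1 + a / tau).
  by rewrite /theta divfK // gt_eqF.
have theta_gt0 : 0 < theta.
  rewrite divr_gt0 // enorm_sqr; case: has_edge => x _.
  rewrite (bigD1 x) //= ltr_pwDl ?exprn_gt0 //.
  by rewrite sumr_ge0 // => y _; rewrite sqr_ge0.
have [_ /=] := nu_eigen; set v := \col_i _ => Av.
pose A := adjmx R G; pose M := theta *: (1%:M + tau^-1 *: A) - v *m v^T.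
have symM : M^T = M.
  rewrite /M !raddfB /= trmx_mul trmxK linearZ /= linearD /= trmx1 linearZ /=.
  by congr (_ *: (_ + _ *: _) - _); apply/matrixP=> i j; rewrite !mxE adj_sym.
have M_ge0 x : eigenvalue M x -> 0 <= x.
  apply: (deflation_eigenvalue_ge0 tau_gt0 theta_gt0 Av); last first.
    by move=> y /A_ge; rewrite opprK.
  rewrite -nu2E enorm_sqr mxE (reindex (@enum_val G G)) /=; last first.
    exact/onW_bij/enum_val_bij.
  by apply: eq_bigr => i _; rewrite !mxE expr2.
have [q qE] := psd_gram symM M_ge0.
(* Adjoining [nu] at index [None] restores the subtracted [v *m v^T], so the Gram matrix of [p] is
   [theta] times [1 + A / tau]. *)
pose p l x := if l is Some l' then q l' (enum_rank x) else nu x.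
have pE x y : \sum_l p l x * p l y =
    theta * ((x == y)%:R + tau^-1 * (adj x y)%:R).
  rewrite (bigD1 None) //= (reindex_omap Some id) => [|[]] //=.
  under eq_bigl do rewrite eqxx.
  rewrite -qE !mxE big_ord1 !mxE !enum_rankK (inj_eq enum_rank_inj) addrC.
  by rewrite subrK.
have p_diag x : \sum_l p l x * p l x = theta.
  by rewrite pE eqxx adj_irr mulr0 addr0 mulr1.
have p_nonadj x y : x != y -> ~~ adj x y -> \sum_l p l x * p l y = 0.
  by rewrite pE => /negbTE -> /negbTE ->; rewrite mulr0 addr0 mulr0.
apply: ge_ereal_sup => _ [k /= k_gt0 <-]; rewrite lee_fin.
have walpha_le : walpha (@tensor_pow R G nu k) <= theta ^+ k.
  apply: bigmax_le => [|U indU]; first by rewrite exprn_ge0 // ltW.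
  exact: (spow_weight_le (q := p) None (ltW theta_gt0)).
have walpha_ge0 : 0 <= walpha (@tensor_pow R G nu k) by exact: bigmax_ge_id.
(* With [theta] written as a [k]-th root, the bound follows from monotonicity of the root; [k_gt0]
   makes the exponents cancel. *)
have -> : theta = (theta ^+ k) `^ k%:R^-1.
  rewrite -powR_mulrn ?ltW // -powRrM divff ?powRr1 ?ltW //.
  by rewrite pnatr_eq0 -lt0n.
by apply: ge0_ler_powR; rewrite ?invr_ge0 ?ler0n ?nnegrE // exprn_ge0 // ltW.
Qed.
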